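(* Let $\mathbf{k}$ be a commutative ring, $A$ a unitary $\mathbf{k}$-algebra, $M$ a left $A$-module, and let $P:A\to A$ and $T:M\to M$ be $\mathbf{k}$-linear maps. Let $\lambda\in\mathbf{k}$, $\lambda\neq 0$, have no zero divisors in $M$ (that is, $\lambda m=0$ with $m\in M$ implies $m=0$). Define $\widetilde{P}=-\lambda\,\mathrm{id}_A-P$ and $\widetilde{T}=-\lambda\,\mathrm{id}_M-T$. Then $(M,P,T)$ is a Rota-Baxter paired $A$-module of weight $\lambda$ if and only if, for any given $a\in A$ and $m\in M$, there is $n\in M$ such that $$P(a)\cdot T(m)=T(n)\quad\text{and}\quad \widetilde{P}(a)\cdot\widetilde{T}(m)=-\widetilde{T}(n).$$
   Context: Algebras are associative and unitary over the commutative ring $\mathbf{k}$, and modules are unitary. For an algebra $A$, a left $A$-module $M$ and $\mathbf{k}$-linear maps $P:A\to A$, $T:M\to M$, the triple $(M,P,T)$ is a Rota-Baxter paired $A$-module of weight $\lambda\in\mathbf{k}$ if $$P(a)\cdot T(m)=T(P(a)\cdot m)+T(a\cdot T(m))+\lambda T(a\cdot m)\quad\text{for all } a\in A,\ m\in M.$$ *)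

(* Defs.v *)
From HB Require Import structures.
From mathcomp Require Import all_boot all_algebra.

Set Implicit Arguments.
Unset Strict Implicit.
Unset Printing Implicit Defensive.

Import GRing.Theory.
Local Open Scope ring_scope.

(* Associative unitary algebras, the zero algebra included: MathComp's algType
   requires 1 != 0, and its hierarchy leaves no room for an HB structure joining
   pzRingType and lmodType below it. *)
Record pzalg_axiom (k : comPzRingType) (A : pzRingType) (scale : k -> A -> A)
    : Prop := PzAlgAxiom {
  pzalg_scaleA : forall c d a, scale c (scale d a) = scale (c * d) a;
  pzalg_scale1 : left_id 1 scale;
  pzalg_scaleDr : right_distributive scale +%R;
  pzalg_scaleDl : forall a, {morph scale^~ a : c d / c + d};
  pzalg_scaleAl : forall c a b, scale c (a * b) = scale c a * b;
  pzalg_scaleAr : forall c a b, scale c (a * b) = a * scale c b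
}.

Record pzAlgType (k : comPzRingType) := PzAlgType {
  pzalg_sort :> Type;
  pzalg_ring : GRing.PzRing pzalg_sort;
  pzalg_scale : k -> pzalg_sort -> pzalg_sort;
  pzalgP : @pzalg_axiom k (GRing.PzRing.Pack pzalg_ring) pzalg_scale
}.

Section PzAlgebra.
Variables (k : comPzRingType) (A : pzAlgType k).

HB.instance Definition _ : GRing.PzRing (pzalg_sort A) := pzalg_ring A.

HB.instance Definition _ := GRing.Zmodule_isLmodule.Build k (pzalg_sort A)
  (pzalg_scaleA (pzalgP A)) (pzalg_scale1 (pzalgP A))
  (pzalg_scaleDr (pzalgP A)) (pzalg_scaleDl (pzalgP A)).

Lemma pzscalerAl (c : k) (a b : A) : c *: (a * b) = (c *: a) * b.
Proof. exact: pzalg_scaleAl (pzalgP A) c a b. Qed.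

Lemma pzscalerAr (c : k) (a b : A) : c *: (a * b) = a * (c *: b).
Proof. exact: pzalg_scaleAr (pzalgP A) c a b. Qed.
End PzAlgebra.

(* An A-module M viewed as a k-module, c acting as c *: 1.  It is an alias since
   M already carries its A-module structure canonically. *)
Definition restr_scalars (k : comPzRingType) (A : pzAlgType k) (M : lmodType A)
  : Type := M.

Section RestrictionOfScalars.
Variables (k : comPzRingType) (A : pzAlgType k) (M : lmodType A).
Local Notation Mk := (restr_scalars M).

HB.instance Definition _ := GRing.Zmodule.copy Mk M.

Definition restr_scale (c : k) (m : Mk) : Mk := (c *: (1 : A)) *: (m : M).

Fact restr_scaleA (c d : k) (m : Mk) :
  restr_scale c (restr_scale d m) = restr_scale (c * d) m.
Proof. by rewrite /restr_scale scalerA -pzscalerAl mul1r scalerA. Qed.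

Fact restr_scale1 : left_id 1 restr_scale.
Proof. by move=> m; rewrite /restr_scale !scale1r. Qed.

Fact restr_scaleDr : right_distributive restr_scale +%R.
Proof. by move=> c m n; rewrite /restr_scale scalerDr. Qed.

Fact restr_scaleDl (m : Mk) : {morph restr_scale^~ m : c d / c + d}.
Proof. by move=> c d; rewrite /restr_scale !scalerDl. Qed.

HB.instance Definition _ := GRing.Zmodule_isLmodule.Build k Mk
  restr_scaleA restr_scale1 restr_scaleDr restr_scaleDl.
End RestrictionOfScalars.

Definition rb_paired_module (k : comPzRingType) (A : pzAlgType k)
    (M : lmodType A) (lam : k) (P : {linear A -> A})
    (T : {linear restr_scalars M -> restr_scalars M}) : Prop :=
  forall (a : A) (m : M),
    P a *: (T m : M) =
      T (P a *: m) + T (a *: (T m : M)) + lam *: T (a *: m).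

Definition rb_tilde (k : comPzRingType) (V : lmodType k) (lam : k)
    (f : {linear V -> V}) (x : V) : V := - (lam *: x) - f x.

(* Main.v *)
(* Put n0 := P(a) m + a T(m) + lam a m.  The Rota-Baxter identity reads
   P(a) T(m) = T(n0), while bilinearity alone gives
   ~P(a) ~T(m) = lam n0 + P(a) T(m); on the other hand - ~T(n) = lam n + T(n).
   So n = n0 is a witness when the identity holds, and conversely any witness n
   satisfies lam n = lam n0, whence n = n0. *)
Require Import Defs.
From HB Require Import structures.
From mathcomp Require Import all_boot all_algebra.

Set Implicit Arguments.
Unset Strict Implicit.
Unset Printing Implicit Defensive.

Import GRing.Theory.
Local Open Scope ring_scope.

Section RestrictedScaling.
Variables (k : comPzRingType) (A : pzAlgType k) (M : lmodType A).
Local Notation Mk := (restr_scalars M).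

Lemma restr_scalerAl (c : k) (a : A) (m : M) :
  (c *: a) *: m = c *: (a *: m : Mk).
Proof.
by rewrite [RHS](_ : _ = (c *: (1 : A)) *: (a *: m)) // scalerA -pzscalerAl mul1r.
Qed.

(** The element [c *: 1] is central in [A], so it moves past [a]. *)
Lemma restr_scalerAr (c : k) (a : A) (m : M) :
  a *: (c *: (m : Mk) : M) = c *: (a *: m : Mk).
Proof.
rewrite -restr_scalerAl [X in a *: X](_ : _ = (c *: (1 : A)) *: m) // scalerA.
by rewrite -pzscalerAr mulr1.
Qed.

End RestrictedScaling.

Section RotaBaxter.
Variables (k : comPzRingType) (A : pzAlgType k) (M : lmodType A) (lam : k).
Variables (P : {linear A -> A}).
Variables (T : {linear restr_scalars M -> restr_scalars M}).
Local Notation Mk := (restr_scalars M).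

(** The n0 of the overview, typed in [Mk] so that [T] and [lam] apply to it. *)
Definition rb_arg (a : A) (m : M) : Mk :=
  (P a *: m : Mk) + (a *: (T m : M) : Mk) + lam *: (a *: m : Mk).

Lemma rb_paired_moduleE :
  rb_paired_module lam P T <->
  forall (a : A) (m : M), P a *: (T m : M) = T (rb_arg a m).
Proof.
by split=> rb a m; rewrite rb /rb_arg !linearD linearZ.
Qed.

Lemma oppr_rb_tilde (V : lmodType k) (f : {linear V -> V}) (x : V) :
  - rb_tilde lam f x = lam *: x + f x.
Proof. by rewrite /rb_tilde opprB opprK addrC. Qed.

Lemma rb_tilde_scale (a : A) (m : M) :
  rb_tilde lam P a *: (rb_tilde lam T m : M) =
    lam *: rb_arg a m + (P a *: (T m : M) : Mk).
Proof.
(* Negating both factors leaves the product unchanged and makes all signs in its expansion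
   positive. *)
rewrite -[LHS]opprK -scaleNr -scalerN oppr_rb_tilde.
(* The opposites in [M] and in [Mk] agree up to conversion, hence the restatement in [M]. *)
have -> : - (rb_tilde lam T m : M) = (lam *: (m : Mk) : M) + (T m : M).
  exact: (oppr_rb_tilde T m).
rewrite scalerDr !scalerDl !restr_scalerAr !restr_scalerAl.
by rewrite /rb_arg !scalerDr addrA; congr (_ + _); rewrite -addrA addrC.
Qed.

End RotaBaxter.

Theorem theorem2p5 (k : comPzRingType) (A : pzAlgType k) (M : lmodType A)
    (P : {linear A -> A})
    (T : {linear restr_scalars M -> restr_scalars M})
    (lam : k) (lam_neq0 : lam != 0)
    (lam_nzd : forall m : restr_scalars M, lam *: m = 0 -> m = 0) :
  rb_paired_module lam P T <->
  forall (a : A) (m : M), exists n : M,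
    P a *: (T m : M) = T n /\
    rb_tilde lam P a *: (rb_tilde lam T m : M) = - rb_tilde lam T n.
Proof.
apply: (iff_trans (rb_paired_moduleE _ _ _)); split=> [rb a m | wit a m].
  exists (rb_arg lam P T a m); split; first exact: rb.
  by rewrite rb_tilde_scale oppr_rb_tilde rb.
have [n [PT]] := wit a m.
(* Both sides end in P(a) T(m) = T(n); cancelling it leaves lam n0 = lam n. *)
rewrite rb_tilde_scale oppr_rb_tilde PT => /addIr lam_n.
suff -> : rb_arg lam P T a m = n by [].
(* [lam] annihilates n0 - n, which is therefore zero. *)
by apply/subr0_eq/lam_nzd; rewrite scalerBr lam_n subrr.
Qed.
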